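(* Fix $\kappa>0$. Let $\bar X_1,\bar X_3\in\mathbb{R}$ satisfy $\bar X_1=\kappa+\tfrac14\bar X_3^2$ with $\bar X_3^2>8\kappa$. Then the set $$\mathcal{W}(\bar X_3)=\{(A,B)\in\mathcal{D}:X_1(A,B)=\bar X_1,\ X_3(A,B)=\bar X_3,\ X_2(A,B)=0\}$$ is nonempty and invariant under the flow of $$\ddot A(t)+\kappa A(t)=\lambda(t)\,\mathrm{cof}\,A(t)\tag{E}$$ in $C^0(\mathbb{R},\mathrm{SL}(2,\mathbb{R}))\cap C^2(\mathbb{R},\mathbb{M}^2)$. Let $0<\mu<\tfrac12(\bar X_3^2-8\kappa)^{1/2}$. If $A\in C^0(\mathbb{R},\mathrm{SL}(2,\mathbb{R}))\cap C^2(\mathbb{R},\mathbb{M}^2)$ is a solution of (E) with initial data $(A(0),\dot A(0))=(A_0,B_0)\in\mathcal{W}(\bar X_3)$, then there exist a time $T>0$ and phases $\theta_\pm$ such that $$\left|\left(\tfrac{d}{dt}\right)^j\left[A(t)-U\left(\tfrac12\bar X_3t+\theta_+\right)\right]\right|\lesssim e^{-\mu t},\quad j=0,1,\quad \langle A(t),\dot A(t)\rangle<0,\quad t>T,$$ and $$\left|\left(\tfrac{d}{dt}\right)^j\left[A(t)-U\left(\tfrac12\bar X_3t+\theta_-\right)\right]\right|\lesssim e^{\mu t},\quad j=0,1,\quad \langle A(t),\dot A(t)\rangle>0,\quad t<-T.$$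
   Context: $\mathbb{M}^2$ is the space of real $2\times2$ matrices with inner product $\langle A,B\rangle=\mathrm{tr}(A^\top B)$ and norm $|A|=\langle A,A\rangle^{1/2}$. $\mathrm{SL}(2,\mathbb{R})=\{A\in\mathbb{M}^2:\det A=1\}$. $Z=\begin{bmatrix}0&-1\\1&0\end{bmatrix}$, $U(\theta)=\cos\theta\,I+\sin\theta\,Z$, and $\mathrm{cof}\,A=ZAZ^\top$ is the cofactor matrix. $\mathcal{D}=\{(A,B)\in\mathbb{M}^2\times\mathbb{M}^2:\det A=1,\ \langle B,\mathrm{cof}\,A\rangle=0\}$ is the tangent bundle of $\mathrm{SL}(2,\mathbb{R})$. $$X_1(A,B)=\tfrac12|B|^2+\tfrac{\kappa}{2}|A|^2,\quad X_2(A,B)=\tfrac12\langle ZA-AZ,B\rangle,\quad X_3(A,B)=\tfrac12\langle ZA+AZ,B\rangle.$$ A solution of (E) means that the equation holds for some $\lambda\in C^0(\mathbb{R},\mathbb{R})$ (necessarily $\lambda(t)=2(\kappa-\det\dot A(t))/|A(t)|^2$); for each initial datum in $\mathcal{D}$ there is a unique global $\mathrm{SL}(2,\mathbb{R})$-valued solution. Invariance of a set under the flow means that if $(A(0),\dot A(0))$ is in the set then so is $(A(t),\dot A(t))$ for all $t\in\mathbb{R}$. The notation $f(t)\lesssim h(t)$ means $f(t)\le Ch(t)$ with a constant $C$ independent of $t$.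
   Formalization: The strict signs of ⟨A,Ȧ⟩ for t>T and t<−T are claimed only when A is not a rigid rotation U(X̄₃t/2+θ); such rotations have data in W and satisfy ⟨A,Ȧ⟩=0 for all t, so the signs fail for them. All other claims cover every solution with data in W. *)

(* Defs.v *)
From HB Require Import structures.
From mathcomp Require Import all_boot all_order all_algebra.
From mathcomp Require Import all_classical all_reals all_analysis.
Set Implicit Arguments.
Unset Strict Implicit.
Unset Printing Implicit Defensive.
Import Order.TTheory GRing.Theory Num.Theory.
Import numFieldNormedType.Exports.
Local Open Scope classical_set_scope.
Local Open Scope ring_scope.

Section Defs.
Context {R : realType}.
Implicit Types (A B : 'M[R]_2) (f : R -> 'M[R]_2) (S : set ('M[R]_2 * 'M[R]_2)).

Definition mxdot A B : R := \tr (A^T *m B).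

(* The Frobenius norm; the library norm `|A| on matrices is the sup norm. *)
Definition mxnorm A : R := Num.sqrt (mxdot A A).

(* Z = [0 -1; 1 0] *)
Definition Zmx : 'M[R]_2 := delta_mx 1 0 - delta_mx 0 1.

Definition Umx (theta : R) : 'M[R]_2 := cos theta *: 1%:M + sin theta *: Zmx.

Definition cof A : 'M[R]_2 := Zmx *m A *m Zmx^T.

Definition SL2 : set 'M[R]_2 := [set A | \det A = 1].

Definition TSL2 : set ('M[R]_2 * 'M[R]_2) :=
  [set P | \det P.1 = 1 /\ mxdot P.2 (cof P.1) = 0].

Definition X1 (kappa : R) A B : R :=
  2^-1 * mxnorm B ^+ 2 + kappa / 2 * mxnorm A ^+ 2.

Definition X2 A B : R := 2^-1 * mxdot (Zmx *m A - A *m Zmx) B.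

Definition X3 A B : R := 2^-1 * mxdot (Zmx *m A + A *m Zmx) B.

Definition Wset (kappa x1 x3 : R) : set ('M[R]_2 * 'M[R]_2) :=
  [set P | [/\ TSL2 P, X1 kappa P.1 P.2 = x1, X3 P.1 P.2 = x3
             & X2 P.1 P.2 = 0]].

Definition C2 f : Prop :=
  [/\ forall t, derivable f t 1, forall t, derivable (derive1 f) t 1
    & continuous (derive1n 2 f)].

Definition is_solution (kappa : R) f : Prop :=
  [/\ continuous f, forall t, SL2 (f t), C2 f
    & exists2 lambda : R -> R, continuous lambda &
        forall t, derive1n 2 f t + kappa *: f t = lambda t *: cof (f t)].

Definition flow_invariant (kappa : R) S : Prop :=
  forall f, is_solution kappa f ->
    S (f 0, derive1 f 0) -> forall t, S (f t, derive1 f t).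

Definition lesssim (I : set R) (g h : R -> R) : Prop :=
  exists C : R, forall t, I t -> g t <= C * h t.

(* Along such a curve mxdot (f t) (derive1 f t) vanishes identically. *)
Definition rigid_rotation (omega : R) f : Prop :=
  exists theta : R, forall t, f t = Umx (omega * t + theta).

End Defs.

(* Main.v *)
Require Import Defs.
From HB Require Import structures.
From mathcomp Require Import all_boot all_order all_algebra.
From mathcomp Require Import all_classical all_reals all_analysis.
From mathcomp Require Import ring lra.
Import Order.TTheory GRing.Theory Num.Theory.
Import numFieldNormedType.Exports.
Local Open Scope classical_set_scope.
Local Open Scope ring_scope.

(** Split A into the complex parts z (commuting with Z) and w (anticommuting
    with Z), so that det A = |z|^2 - |w|^2 and the equation of motion reads
    z'' = (lam - kappa) z, w'' = - (lam + kappa) w. Both forces are central, so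
    the angular momenta of z and w, which are X3 / 2 and X2 / 2, are conserved;
    so is the energy X1, the constraint force being orthogonal to the velocity.
    Hence W is invariant; it contains the identity moving with velocity omega Z,
    where omega = x3 / 2.

    On W the whole motion is governed by s = |w|^2, which vanishes at the
    rotations. As w has no angular momentum, s'^2 = 4 s |w'|^2, and the
    conservation laws give, with m^2 = omega^2 - 2 kappa > 0,
      (s' / s)^2 = 4 (m^2 - 2 kappa s) / (1 + 2 s),
      (s' / s)' = - 4 (omega^2 - kappa) s / (1 + 2 s)^2 < 0
    (rate_sqrE, is_derive_rate). If s vanishes at one time then, as |s'| is at
    most a multiple of s, it vanishes identically and A is a rotation of angular
    velocity omega (dev_eq0_all, dev0_rigid). Otherwise, for 0 < mu < m, the
    rate s' / s falls below - 2 mu for good: if it did not, s would stay bounded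
    below and the decreasing rate would tend to -oo (rate_eventually_le).
    So s decays like exp (- 2 mu t), and <A, A'> = 2 s' is eventually negative.

    It remains to find the phase. The same conservation laws show that
    |z' - i omega z| is at most a multiple of s, so that
    exp (- i omega t) z(t) has a derivative dominated by a multiple of - s' and
    converges, with error of order s, to a point exp (i theta) of the unit circle
    (drift_sqr_le, phase_limit). The parts w and w' are of order the square
    root of s, which yields the rate exp (- mu t). The behaviour at -oo follows
    by applying this to t |-> A (- t), which is a curve of the same kind for
    - omega (homoclinic_reverse). *)

Set Implicit Arguments.
Unset Strict Implicit.
Unset Printing Implicit Defensive.

(** * Derivatives of real functions written pointwise *)

Section ScalarCalculus.
Context {R : realType}.
Implicit Types (f g : R -> R) (t a b c : R).

Lemma is_derive_congr f g t a b :
  is_derive t 1 f a -> f =1 g -> a = b -> is_derive t 1 g b.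
Proof. by move=> fa /funext <- <-. Qed.

Lemma is_derive_addf f g t a b :
  is_derive t 1 f a -> is_derive t 1 g b ->
  is_derive t 1 (fun x => f x + g x) (a + b).
Proof. by move=> fa gb; exact: (@is_deriveD _ _ _ f g). Qed.

Lemma is_derive_subf f g t a b :
  is_derive t 1 f a -> is_derive t 1 g b ->
  is_derive t 1 (fun x => f x - g x) (a - b).
Proof. by move=> fa gb; exact: (@is_deriveB _ _ _ f g). Qed.

Lemma is_derive_oppf f t a :
  is_derive t 1 f a -> is_derive t 1 (fun x => - f x) (- a).
Proof. by move=> fa; exact: (@is_deriveN _ _ _ f). Qed.

Lemma is_derive_mulf f g t a b :
  is_derive t 1 f a -> is_derive t 1 g b ->
  is_derive t 1 (fun x => f x * g x) (a * g t + f t * b).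
Proof.
move=> fa gb; apply: (@is_derive_eq _ _ _ (f * g)).
by rewrite /GRing.scale /=; ring.
Qed.

Lemma is_derive_sqrf f t a :
  is_derive t 1 f a -> is_derive t 1 (fun x => f x ^+ 2) (2 * f t * a).
Proof.
move=> fa; under eq_fun do rewrite expr2.
have -> : 2 * f t * a = a * f t + f t * a by ring.
exact: is_derive_mulf.
Qed.

Lemma is_derive_invf f t a : f t != 0 ->
  is_derive t 1 f a -> is_derive t 1 (fun x => (f x)^-1) (- a / f t ^+ 2).
Proof.
move=> ft0 fa; have -> : - a / f t ^+ 2 = - f t ^- 2 *: a.
  by rewrite /GRing.scale /=; ring.
exact: is_deriveV.
Qed.

Lemma is_derive_idf t : is_derive t 1 (fun x => x) 1.
Proof. exact: is_derive_id. Qed.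

Lemma is_derive_cstf c t : is_derive t 1 (fun=> c) 0.
Proof. exact: is_derive_cst. Qed.

Lemma is_derive_cosf f t a : is_derive t 1 f a ->
  is_derive t 1 (fun x => cos (f x)) (- sin (f t) * a).
Proof. by move=> fa; exact: (@is_derive1_comp _ cos f). Qed.

Lemma is_derive_sinf f t a : is_derive t 1 f a ->
  is_derive t 1 (fun x => sin (f x)) (cos (f t) * a).
Proof. by move=> fa; exact: (@is_derive1_comp _ sin f). Qed.

Lemma is_derive_expf f t a : is_derive t 1 f a ->
  is_derive t 1 (fun x => expR (f x)) (expR (f t) * a).
Proof. by move=> fa; exact: (@is_derive1_comp _ expR f). Qed.

End ScalarCalculus.

Lemma is_derive_val (R : realType) (f : R -> R) (t a b : R) :
  is_derive t 1 f a -> a = b -> is_derive t 1 f b.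
Proof. by move=> fa <-. Qed.

(** Computes a derivative syntactically, using derivatives found in the
    context. Instance resolution is switched off so that the derivative found
    is the expression given by the rules above. *)
Ltac derive_rules := repeat first
  [ eassumption
  | notypeclasses refine (is_derive_idf _)
  | notypeclasses refine (is_derive_cstf _ _)
  | notypeclasses refine (is_derive_addf _ _)
  | notypeclasses refine (is_derive_subf _ _)
  | notypeclasses refine (is_derive_oppf _)
  | notypeclasses refine (is_derive_sqrf _)
  | notypeclasses refine (is_derive_mulf _ _)
  | notypeclasses refine (is_derive_cosf _)
  | notypeclasses refine (is_derive_sinf _)
  | notypeclasses refine (is_derive_expf _) ].

(** Reduces a claimed derivative to its equality with the computed one. *)
Ltac derive_by :=
  notypeclasses refine (is_derive_val _ _); [derive_rules | cbv beta].

(** * Monotonicity and limits *)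

Section Monotone.
Context {R : realType}.
Implicit Types (f df : R -> R) (t a b c : R).

Lemma is_derive_continuous_within f df a b :
  (forall t, is_derive t 1 f (df t)) -> {within `[a, b], continuous f}.
Proof.
move=> fd; apply: continuous_subspaceT => t.
by apply/differentiable_continuous/derivable1_diffP; case: (fd t).
Qed.

Lemma is_derive_slope_le f df a b c : a <= b ->
  (forall t, is_derive t 1 f (df t)) ->
  (forall t, a <= t <= b -> df t <= c) -> f b - f a <= c * (b - a).
Proof.
move=> ab fd dfc.
have [t] := MVT_segment ab (fun t _ => fd t) (is_derive_continuous_within fd).
by rewrite in_itv/= => tab ->; rewrite ler_wpM2r ?subr_ge0 ?dfc.
Qed.

Lemma is_derive_le0_nincr f df a b : a <= b ->
  (forall t, is_derive t 1 f (df t)) ->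
  (forall t, a <= t <= b -> df t <= 0) -> f b <= f a.
Proof.
move=> ab fd df0; have := is_derive_slope_le ab fd df0.
by rewrite mul0r subr_le0.
Qed.

Lemma is_derive_ge0_ndecr f df a b : a <= b ->
  (forall t, is_derive t 1 f (df t)) ->
  (forall t, a <= t <= b -> 0 <= df t) -> f a <= f b.
Proof.
move=> ab fd df0; rewrite -lerN2.
apply: (@is_derive_le0_nincr (fun t => - f t) (fun t => - df t)) => // t.
by move=> tab; rewrite oppr_le0 df0.
Qed.

Lemma is_derive0_const f : (forall t, is_derive t 1 f 0) -> forall t, f t = f 0.
Proof. by move=> fd t; exact: is_derive_0_is_cst. Qed.

Lemma is_derive_const0 f c t a : (forall t, f t = c) ->
  is_derive t 1 f a -> a = 0.
Proof.
move=> fc; have -> : f = cst c by apply/funext.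
by move=> [_ <-]; rewrite derive_cst.
Qed.

End Monotone.

Section RealLimits.
Context {R : realType}.

(** A function whose oscillation is dominated by the decrease of h >= 0 is
    within h of some limit value. *)
Lemma controlled_limit (f h : R -> R) (T : R) :
  (forall t, T <= t -> 0 <= h t) ->
  (forall a b, T <= a -> a <= b -> `|f b - f a| <= h a - h b) ->
  exists l, forall t, T <= t -> `|f t - l| <= h t.
Proof.
move=> h0 fh; pose E := [set f t - h t | t in [set t | T <= t]].
have ubE t : T <= t -> ubound E (f t + h t).
  move=> Tt _ [a /= Ta <-]; have := h0 _ Tt; have := h0 _ Ta.
  case/orP: (le_total a t) => [at_|ta].
    by have := fh _ _ Ta at_; rewrite ler_norml => /andP[]; lra.
  by have := fh _ _ Tt ta; rewrite ler_norml => /andP[]; lra.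
have E0 : E !=set0 by exists (f T - h T); exists T => /=.
exists (sup E) => t Tt.
have le1 : f t - h t <= sup E.
  by apply: ub_le_sup; [exists (f T + h T); exact: ubE | exists t].
have le2 : sup E <= f t + h t by apply: ge_sup => //; exact: ubE.
by rewrite ler_norml; lra.
Qed.

Lemma unit_circle_angle (x y : R) : x ^+ 2 + y ^+ 2 = 1 ->
  exists theta, x = cos theta /\ y = sin theta.
Proof.
move=> xy1; have x1 : -1 <= x <= 1.
  rewrite -ler_norml -(@expr_le1 _ 2)// real_normK ?num_real// -xy1.
  by rewrite lerDl sqr_ge0.
have cx : cos (acos x) = x by apply: acosK; rewrite in_itv.
have sx : sin (acos x) = `|y|.
  by rewrite sin_acos// (_ : 1 - x ^+ 2 = y ^+ 2) ?sqrtr_sqr// -xy1; ring.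
have [y0|y0] := leP 0 y.
  by exists (acos x); rewrite cx sx ger0_norm.
by exists (- acos x); rewrite cosN sinN cx sx ltr0_norm// opprK.
Qed.

Lemma sqr_le_norm_le (x y : R) : 0 <= y -> x ^+ 2 <= y ^+ 2 -> `|x| <= y.
Proof. by move=> y0; rewrite -(real_normK (num_real x)) ler_sqr. Qed.

Lemma norm_rotation_le (theta x y c : R) : `|x| <= c -> `|y| <= c ->
  `|cos theta * x - sin theta * y| <= 2 * c.
Proof.
move=> xc yc; apply: (le_trans (ler_normB _ _)); rewrite !normrM.
have h (u v : R) : `|u| <= 1 -> `|v| <= c -> `|u| * `|v| <= c.
  by move=> u1 vc; rewrite -[leRHS]mul1r ler_pM.
have c1 : `|cos theta| <= 1.
  by rewrite ler_norml cos_geN1 cos_le1.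
have s1 : `|sin theta| <= 1.
  by rewrite ler_norml sin_geN1 sin_le1.
by have := h _ _ c1 xc; have := h _ _ s1 yc; lra.
Qed.

End RealLimits.

(** * Complex coordinates on real 2 x 2 matrices *)

Section Coordinates.
Context {R : realType}.
Implicit Types (A B M : 'M[R]_2) (a t theta : R).

(** A real 2 x 2 matrix A = [a b; c d] is determined by two complex numbers:
    z(A) = zre A + i zim A, the part of A commuting with the rotation Z, and
    w(A) = wre A + i wim A, the part anticommuting with Z. With this
    normalization det A = |z|^2 - |w|^2 and |A|^2 = 2 (|z|^2 + |w|^2). *)
Definition zre A : R := (A 0 0 + A 1 1) / 2.
Definition zim A : R := (A 1 0 - A 0 1) / 2.
Definition wre A : R := (A 0 0 - A 1 1) / 2.
Definition wim A : R := (A 0 1 + A 1 0) / 2.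

Lemma ord2_ind (P : 'I_2 -> Prop) : P 0 -> P 1 -> forall i, P i.
Proof.
move=> P0 P1 [[|[|//]] lti2].
  by rewrite (_ : Ordinal lti2 = 0) //; exact/val_inj.
by rewrite (_ : Ordinal lti2 = 1) //; exact/val_inj.
Qed.

Lemma mx2P A B :
  zre A = zre B -> zim A = zim B -> wre A = wre B -> wim A = wim B -> A = B.
Proof.
rewrite /zre /zim /wre /wim => e1 e2 e3 e4; apply/matrixP.
by elim/ord2_ind; elim/ord2_ind; lra.
Qed.

Lemma sum_ord2 (F : 'I_2 -> R) : \sum_(i < 2) F i = F 0 + F 1.
Proof.
by rewrite big_ord_recl big_ord1; congr (_ + F _); exact/val_inj.
Qed.

Lemma mxdotE A B : mxdot A B =
  2 * (zre A * zre B + zim A * zim B + wre A * wre B + wim A * wim B).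
Proof.
rewrite /mxdot /mxtrace sum_ord2 !mxE !sum_ord2 !mxE /zre /zim /wre /wim.
by field.
Qed.

Lemma mxnorm_sqrE A : mxnorm A ^+ 2 =
  2 * (zre A ^+ 2 + zim A ^+ 2 + wre A ^+ 2 + wim A ^+ 2).
Proof.
rewrite /mxnorm sqr_sqrtr mxdotE; first by ring.
by rewrite mulr_ge0// !addr_ge0// -expr2 sqr_ge0.
Qed.

Lemma mxdotNr A B : mxdot A (- B) = - mxdot A B.
Proof. by rewrite /mxdot mulmxN raddfN. Qed.

Lemma mxnormN A : mxnorm (- A) = mxnorm A.
Proof. by rewrite /mxnorm mxdotNr /mxdot linearN mulNmx raddfN opprK. Qed.

(** The constant 3 is a convenient upper bound for the sharp constant, which
    is the square root of 8. *)
Lemma mxnorm_le A c : 0 <= c ->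
  `|zre A| <= c -> `|zim A| <= c -> `|wre A| <= c -> `|wim A| <= c ->
  mxnorm A <= 3 * c.
Proof.
move=> c0 z1 z2 w1 w2; rewrite -ler_sqr ?nnegrE ?mulr_ge0 ?sqrtr_ge0//.
have sq x : `|x| <= c -> x ^+ 2 <= c ^+ 2.
  by move=> xc; rewrite -real_normK ?num_real// ler_sqr ?nnegrE.
move: (sq _ z1) (sq _ z2) (sq _ w1) (sq _ w2) (sqr_ge0 c).
by rewrite mxnorm_sqrE exprMn; lra.
Qed.

Lemma det_coord A :
  \det A = zre A ^+ 2 + zim A ^+ 2 - wre A ^+ 2 - wim A ^+ 2.
Proof.
have l0 : lift 0 0 = 1 :> 'I_2 by exact/val_inj.
have l1 : lift 1 0 = 0 :> 'I_2 by exact/val_inj.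
rewrite (expand_det_row _ 0) sum_ord2 /cofactor !det_mx11 !mxE l0 l1 /=.
by rewrite expr0 expr1 /zre /zim /wre /wim; field.
Qed.

Lemma coordN A : (zre (- A) = - zre A) * (zim (- A) = - zim A) *
  (wre (- A) = - wre A) * (wim (- A) = - wim A).
Proof. by rewrite /zre /zim /wre /wim !mxE; do !split; field. Qed.

Lemma coordZ a A : (zre (a *: A) = a * zre A) * (zim (a *: A) = a * zim A) *
  (wre (a *: A) = a * wre A) * (wim (a *: A) = a * wim A).
Proof. by rewrite /zre /zim /wre /wim !mxE; do !split; field. Qed.

Lemma coordD A B :
  (zre (A + B) = zre A + zre B) * (zim (A + B) = zim A + zim B) *
  (wre (A + B) = wre A + wre B) * (wim (A + B) = wim A + wim B).
Proof. by rewrite /zre /zim /wre /wim !mxE; do !split; field. Qed.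

Lemma coord1 : (zre 1%:M = 1) * (zim 1%:M = 0) * (wre 1%:M = 0) *
  (wim 1%:M = 0).
Proof. by rewrite /zre /zim /wre /wim !mxE /=; do !split; field. Qed.

Lemma coordZmx : (zre (Zmx : 'M[R]_2) = 0) * (zim (Zmx : 'M[R]_2) = 1) *
  (wre (Zmx : 'M[R]_2) = 0) * (wim (Zmx : 'M[R]_2) = 0).
Proof. by rewrite /zre /zim /wre /wim !mxE /=; do !split; field. Qed.

Lemma coord_mulmx A B :
  [/\ zre (A *m B) = zre A * zre B - zim A * zim B
        + wre A * wre B + wim A * wim B,
      zim (A *m B) = zre A * zim B + zim A * zre B
        + wim A * wre B - wre A * wim B,
      wre (A *m B) = zre A * wre B - zim A * wim B
        + wre A * zre B + wim A * zim B
    & wim (A *m B) = zre A * wim B + zim A * wre B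
        + wim A * zre B - wre A * zim B].
Proof.
by rewrite /zre /zim /wre /wim !mxE !sum_ord2; split; field.
Qed.

Lemma coord_trmx A : (zre A^T = zre A) * (zim A^T = - zim A) *
  (wre A^T = wre A) * (wim A^T = wim A).
Proof. by rewrite /zre /zim /wre /wim !mxE; do !split; field. Qed.

Lemma coord_cof A : (zre (cof A) = zre A) * (zim (cof A) = zim A) *
  (wre (cof A) = - wre A) * (wim (cof A) = - wim A).
Proof.
rewrite /cof; have [-> -> -> ->] := coord_mulmx (Zmx *m A) Zmx^T.
have [-> -> -> ->] := coord_mulmx Zmx A.
by rewrite !coord_trmx !coordZmx; do !split; ring.
Qed.

Lemma coord_Umx theta : (zre (Umx theta) = cos theta) *
  (zim (Umx theta) = sin theta) * (wre (Umx theta) = 0) *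
  (wim (Umx theta) = 0).
Proof. by rewrite /Umx !coordD !coordZ !coord1 !coordZmx; do !split; ring. Qed.

Lemma coord_ZUmx theta : (zre (Zmx *m Umx theta) = - sin theta) *
  (zim (Zmx *m Umx theta) = cos theta) * (wre (Zmx *m Umx theta) = 0) *
  (wim (Zmx *m Umx theta) = 0).
Proof.
have [-> -> -> ->] := coord_mulmx Zmx (Umx theta).
by rewrite !coord_Umx !coordZmx; do !split; ring.
Qed.

Lemma mxdot_cof A B : mxdot B (cof A) =
  2 * (zre A * zre B + zim A * zim B - wre A * wre B - wim A * wim B).
Proof. by rewrite mxdotE !coord_cof; ring. Qed.

Lemma X1E kappa A B : X1 kappa A B =
  zre B ^+ 2 + zim B ^+ 2 + wre B ^+ 2 + wim B ^+ 2 +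
  kappa * (zre A ^+ 2 + zim A ^+ 2 + wre A ^+ 2 + wim A ^+ 2).
Proof. by rewrite /X1 !mxnorm_sqrE; field. Qed.

Lemma X2E A B : X2 A B = 2 * (wre A * wim B - wim A * wre B).
Proof.
rewrite /X2 mxdotE !coordD !coordN.
have [-> -> -> ->] := coord_mulmx Zmx A.
have [-> -> -> ->] := coord_mulmx A Zmx.
by rewrite !coordZmx; field.
Qed.

Lemma X3E A B : X3 A B = 2 * (zre A * zim B - zim A * zre B).
Proof.
rewrite /X3 mxdotE !coordD.
have [-> -> -> ->] := coord_mulmx Zmx A.
have [-> -> -> ->] := coord_mulmx A Zmx.
by rewrite !coordZmx; field.
Qed.

(** In coordinates, X2 and X3 are twice the angular momenta of w and z. *)
Lemma WsetP kappa x1 x3 A B : Wset kappa x1 x3 (A, B) <->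
  [/\ zre A ^+ 2 + zim A ^+ 2 - wre A ^+ 2 - wim A ^+ 2 = 1 /\
      zre A * zre B + zim A * zim B - wre A * wre B - wim A * wim B = 0,
      zre B ^+ 2 + zim B ^+ 2 + wre B ^+ 2 + wim B ^+ 2 +
        kappa * (zre A ^+ 2 + zim A ^+ 2 + wre A ^+ 2 + wim A ^+ 2) = x1,
      2 * (zre A * zim B - zim A * zre B) = x3 &
      wre A * wim B - wim A * wre B = 0].
Proof.
rewrite /Wset /TSL2 /= det_coord mxdot_cof X1E X2E X3E.
split=> -[[h1 h2] h3 h4 h5]; split => //; [split=> //| |split=> //|]; lra.
Qed.

Lemma is_derive_mxP (M : R -> 'M[R]_2) t dM :
  is_derive t 1 M dM <->
  forall i j, is_derive t 1 (fun x => M x i j) (dM i j).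
Proof.
split=> [[dMt <-] i j|dMt].
  split; first by move/derivable_mxP: dMt; exact.
  by rewrite derive_mx// mxE.
have Mt : derivable M t 1 by apply/derivable_mxP => i j; case: (dMt i j).
split=> //; rewrite derive_mx//; apply/matrixP => i j; rewrite mxE.
by case: (dMt i j).
Qed.

Lemma is_derive_coord (M : R -> 'M[R]_2) t dM : is_derive t 1 M dM ->
  [/\ is_derive t 1 (fun x => zre (M x)) (zre dM),
      is_derive t 1 (fun x => zim (M x)) (zim dM),
      is_derive t 1 (fun x => wre (M x)) (wre dM)
    & is_derive t 1 (fun x => wim (M x)) (wim dM)].
Proof.
move/is_derive_mxP => dMt.
have h00 := dMt 0 0; have h01 := dMt 0 1.
have h10 := dMt 1 0; have h11 := dMt 1 1.
have half (f : R -> R) a : is_derive t 1 f a ->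
    is_derive t 1 (fun x => f x / 2) (a / 2).
  move=> fa; have -> : a / 2 = a * 2^-1 + f t * 0 by ring.
  by apply: is_derive_mulf => //; exact: is_derive_cstf.
by split; apply: half; derive_rules.
Qed.

Lemma is_derive_coordP (M : R -> 'M[R]_2) t dM :
  is_derive t 1 (fun x => zre (M x)) (zre dM) ->
  is_derive t 1 (fun x => zim (M x)) (zim dM) ->
  is_derive t 1 (fun x => wre (M x)) (wre dM) ->
  is_derive t 1 (fun x => wim (M x)) (wim dM) -> is_derive t 1 M dM.
Proof.
move=> h1 h2 h3 h4; apply/is_derive_mxP.
elim/ord2_ind; elim/ord2_ind.
- by apply: (is_derive_congr (is_derive_addf h1 h3)) => [x|];
    rewrite /zre /wre; field.
- by apply: (is_derive_congr (is_derive_subf h4 h2)) => [x|];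
    rewrite /wim /zim; field.
- by apply: (is_derive_congr (is_derive_addf h4 h2)) => [x|];
    rewrite /wim /zim; field.
- by apply: (is_derive_congr (is_derive_subf h1 h3)) => [x|];
    rewrite /zre /wre; field.
Qed.

Lemma is_derive_Umx a theta t :
  is_derive t 1 (fun x => Umx (a * x + theta))
    (a *: (Zmx *m Umx (a * t + theta))).
Proof.
have du : is_derive t 1 (fun x => a * x + theta) a.
  derive_by; ring.
by apply: is_derive_coordP; rewrite !coordZ coord_ZUmx;
  under eq_fun do rewrite coord_Umx; derive_by; ring.
Qed.

End Coordinates.

(** * The flow in coordinates and its invariants *)

Section Dynamics.
Context {R : realType}.
Implicit Types (kappa x omega t : R) (A B : R -> 'M[R]_2) (lam : R -> R).

(** B is the velocity of A, and the acceleration of A is the one prescribed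
    by the equation of motion with multiplier lam. The constraint det A = 1 is
    not part of this definition. *)
Definition flow_curve kappa A B lam : Prop := forall t,
  is_derive t 1 A (B t) /\
  is_derive t 1 B (lam t *: cof (A t) + - (kappa *: A t)).

Lemma solution_flow_curve kappa A : is_solution kappa A ->
  exists lam, flow_curve kappa A (derive1 A) lam.
Proof.
case=> _ _ [dA ddA _] [lam _ E]; exists lam => t; split.
  by split; [exact: dA | rewrite derive1E].
split; [exact: ddA | rewrite -derive1E -E].
by rewrite derive1nS derive1n1 addrK.
Qed.

(** The equation decouples into z'' = (lam - kappa) z and
    w'' = - (lam + kappa) w: the cofactor map fixes z and changes the sign
    of w. *)
Lemma flow_curve_coord kappa A B lam t : flow_curve kappa A B lam ->
  [/\ [/\ is_derive t 1 (fun x => zre (A x)) (zre (B t)),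
      is_derive t 1 (fun x => zim (A x)) (zim (B t)),
      is_derive t 1 (fun x => wre (A x)) (wre (B t))
    & is_derive t 1 (fun x => wim (A x)) (wim (B t))],
      is_derive t 1 (fun x => zre (B x)) ((lam t - kappa) * zre (A t)),
      is_derive t 1 (fun x => zim (B x)) ((lam t - kappa) * zim (A t)),
      is_derive t 1 (fun x => wre (B x)) (- (lam t + kappa) * wre (A t))
    & is_derive t 1 (fun x => wim (B x)) (- (lam t + kappa) * wim (A t))].
Proof.
move=> /(_ t)[dA dB]; split; first exact: is_derive_coord.
all: case: (is_derive_coord dB); rewrite !coordD !coordN !coordZ !coord_cof.
- by move=> + _ _ _; rewrite mulrBl.
- by move=> _ + _ _; rewrite mulrBl.
- by move=> _ _ + _; rewrite mulNr mulrDl opprD mulrN.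
- by move=> _ _ _ +; rewrite mulNr mulrDl opprD mulrN.
Qed.

(** Both central forces conserve angular momentum, hence X2 and X3; the
    derivative of X1 is lam times the derivative of det A, which vanishes. *)
Lemma Wset_invariant kappa x1 x3 A B lam : flow_curve kappa A B lam ->
  (forall t, \det (A t) = 1) -> Wset kappa x1 x3 (A 0, B 0) ->
  forall t, Wset kappa x1 x3 (A t, B t).
Proof.
move=> AB detA /WsetP [_ h1 h3 h2] t; apply/WsetP.
have D1 u : zre (A u) ^+ 2 + zim (A u) ^+ 2 - wre (A u) ^+ 2 - wim (A u) ^+ 2
    = 1 by rewrite -det_coord.
have D2 u : zre (A u) * zre (B u) + zim (A u) * zim (B u)
    - wre (A u) * wre (B u) - wim (A u) * wim (B u) = 0.
  have [[d1 d2 d3 d4] _ _ _ _] := flow_curve_coord u AB.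
  apply: (mulfI (_ : 2 != 0 :> R)); first by rewrite pnatr_eq0.
  rewrite mulr0; apply: (is_derive_const0 (t := u) D1).
  by derive_by; ring.
split; first by split.
- rewrite -h1; move: t; apply: is_derive0_const => t.
  have [[d1 d2 d3 d4] d5 d6 d7 d8] := flow_curve_coord t AB.
  (* the derivative of X1 is a multiple of the tangency condition D2 *)
  derive_by; transitivity (2 * lam t * (zre (A t) * zre (B t) +
    zim (A t) * zim (B t) - wre (A t) * wre (B t) - wim (A t) * wim (B t))).
    ring.
  by rewrite D2 mulr0.
- rewrite -h3; move: t; apply: is_derive0_const => t.
  have [[d1 d2 d3 d4] d5 d6 d7 d8] := flow_curve_coord t AB.
  derive_by; ring.
- rewrite -h2; move: t; apply: is_derive0_const => t.
  have [[d1 d2 d3 d4] d5 d6 d7 d8] := flow_curve_coord t AB.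
  derive_by; ring.
Qed.

(** A flow curve lying in the set W for x3 = 2 omega; rotations of angular
    velocity omega are included, although they are not homoclinic proper. The
    number omega is the angular velocity of the limiting rotations. *)
Definition homoclinic kappa omega A B lam : Prop :=
  flow_curve kappa A B lam /\
  forall t, Wset kappa (kappa + omega ^+ 2) (2 * omega) (A t, B t).

Lemma homoclinic_reverse kappa omega A B lam : homoclinic kappa omega A B lam ->
  homoclinic kappa (- omega) (fun t => A (- t)) (fun t => - B (- t))
    (fun t => lam (- t)).
Proof.
have rev (f : R -> R) t a : is_derive (- t) 1 f a ->
    is_derive t 1 (fun x => f (- x)) (- a).
  move=> fa; have -> : - a = a * -1 by ring.
  by apply: (@is_derive1_comp _ f (fun x => - x)); exact: is_derive_oppf.
case=> AB W; split=> [t|t]; last first.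
  have /WsetP[[e1 e2] e3 e4 e5] := W (- t); apply/WsetP; rewrite !coordN.
  by rewrite !sqrrN; split=> //; [split=> //|..]; lra.
have [[d1 d2 d3 d4] d5 d6 d7 d8] := flow_curve_coord (- t) AB.
split; apply: is_derive_coordP; rewrite ?coordD !coordN ?coordZ ?coord_cof.
- exact: rev.
- exact: rev.
- exact: rev.
- exact: rev.
all: under eq_fun do rewrite coordN.
- by have h := rev _ _ _ d5; derive_by; ring.
- by have h := rev _ _ _ d6; derive_by; ring.
- by have h := rev _ _ _ d7; derive_by; ring.
- by have h := rev _ _ _ d8; derive_by; ring.
Qed.

End Dynamics.

(** * The squared distance to the rotations *)

Section Deviation.
Context {R : realType} (kappa omega : R) (A B : R -> 'M[R]_2) (lam : R -> R).
Hypothesis AB : homoclinic kappa omega A B lam.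

(** |w(M)|^2. On SL(2,R) it vanishes exactly at the rotations; it is
    also used for velocities. *)
Definition dev (M : 'M[R]_2) : R := wre M ^+ 2 + wim M ^+ 2.

Local Notation s t := (dev (A t)).
(* ds is the derivative of s along the curve. *)
Local Notation ds t :=
  (2 * (wre (A t) * wre (B t) + wim (A t) * wim (B t))).
(* When positive, m2 is the square of the rate at which w grows or decays
   near the rotations. *)
Local Notation m2 := (omega ^+ 2 - 2 * kappa).

Lemma dev_ge0 M : 0 <= dev M.
Proof. by rewrite addr_ge0 ?sqr_ge0. Qed.

Lemma zsqrE t : zre (A t) ^+ 2 + zim (A t) ^+ 2 = 1 + s t.
Proof. by case: AB => _ /(_ t) /WsetP[[e1 _] _ _ _]; rewrite /dev; lra. Qed.

Lemma zspeedE t : zre (B t) ^+ 2 + zim (B t) ^+ 2 =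
  omega ^+ 2 - 2 * kappa * s t - dev (B t).
Proof.
case: AB => _ /(_ t) /WsetP[[_ _] e3 _ _].
have e1 := zsqrE t.
have : kappa * (zre (A t) ^+ 2 + zim (A t) ^+ 2) = kappa * (1 + s t).
  by rewrite e1.
by move: e3; rewrite /dev; lra.
Qed.

(** Conservation of energy, with |z'| eliminated through the identity
    |z|^2 |z'|^2 = (z . z')^2 + (z x z')^2 and z . z' = w . w'. *)
Lemma wspeedE t : dev (B t) * (1 + 2 * s t) = s t * (m2 - 2 * kappa * s t).
Proof.
case: AB => _ /(_ t) /WsetP[[_ e2] _ e4 e5].
set z1 := zre (A t) in e2 e4 *; set z2 := zim (A t) in e2 e4 *.
set p1 := zre (B t) in e2 e4 *; set p2 := zim (B t) in e2 e4 *.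
have h : (1 + s t) * (p1 ^+ 2 + p2 ^+ 2) = s t * dev (B t) + omega ^+ 2.
  rewrite -zsqrE -/z1 -/z2.
  have -> : (z1 ^+ 2 + z2 ^+ 2) * (p1 ^+ 2 + p2 ^+ 2) =
    (z1 * p1 + z2 * p2) ^+ 2 + (z1 * p2 - z2 * p1) ^+ 2 by ring.
  have -> : z1 * p2 - z2 * p1 = omega by lra.
  have -> : z1 * p1 + z2 * p2 = wre (A t) * wre (B t) + wim (A t) * wim (B t).
    by lra.
  have -> : s t * dev (B t) =
    (wre (A t) * wre (B t) + wim (A t) * wim (B t)) ^+ 2 +
    (wre (A t) * wim (B t) - wim (A t) * wre (B t)) ^+ 2 by rewrite /dev; ring.
  by rewrite e5; ring.
by move: h; rewrite zspeedE; lra.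
Qed.

(** Since w has no angular momentum, |w . w'|^2 = |w|^2 |w'|^2. *)
Lemma ds_sqrE t : ds t ^+ 2 = 4 * s t * dev (B t).
Proof.
case: AB => _ /(_ t) /WsetP[_ _ _ e5].
have -> : 4 * s t * dev (B t) = ds t ^+ 2 +
  4 * (wre (A t) * wim (B t) - wim (A t) * wre (B t)) ^+ 2
  by rewrite /dev; ring.
by rewrite e5; ring.
Qed.

Lemma is_derive_dev (t : R) : is_derive t 1 (fun x => s x) (ds t).
Proof.
have [[d1 d2 d3 d4] _ _ _ _] := flow_curve_coord t AB.1.
by rewrite /dev; derive_by; ring.
Qed.

(** The multiplier is obtained by differentiating the tangency condition
    z . z' = w . w'. *)
Lemma multiplierE t : lam t * (1 + 2 * s t) =
  kappa - omega ^+ 2 + 2 * kappa * s t + 2 * dev (B t).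
Proof.
have [[d1 d2 d3 d4] d5 d6 d7 d8] := flow_curve_coord t AB.1.
have D2 u : zre (A u) * zre (B u) + zim (A u) * zim (B u)
    - wre (A u) * wre (B u) - wim (A u) * wim (B u) = 0.
  by case: AB => _ /(_ u) /WsetP[[_ e2] _ _ _].
have : zre (B t) ^+ 2 + zim (B t) ^+ 2 - dev (B t)
   + (lam t - kappa) * (zre (A t) ^+ 2 + zim (A t) ^+ 2)
   + (lam t + kappa) * s t = 0.
  by apply: (is_derive_const0 (t := t) D2); rewrite /dev; derive_by; ring.
by rewrite zspeedE zsqrE; lra.
Qed.

Lemma is_derive_ds (t : R) : is_derive t 1 (fun x => ds x)
  (2 * dev (B t) - 2 * (kappa + lam t) * s t).
Proof.
have [[d1 d2 d3 d4] d5 d6 d7 d8] := flow_curve_coord t AB.1.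
by rewrite /dev; derive_by; ring.
Qed.

(** The logarithmic derivative of s. *)
Definition rate t : R := ds t / s t.

Lemma dev_1D2_gt0 t : 0 < 1 + 2 * s t.
Proof. by have := dev_ge0 (A t); lra. Qed.

(** At s = 0 the right-hand side is 4 m2: near a rotation, s grows or decays
    with rate close to twice the square root of m2. *)
Lemma rate_sqrE t : 0 < s t ->
  rate t ^+ 2 * (1 + 2 * s t) = 4 * (m2 - 2 * kappa * s t).
Proof.
move=> s0; rewrite /rate expr_div_n ds_sqrE.
have := wspeedE t; set Q := dev (B t) => e.
have -> : 4 * s t * Q / s t ^+ 2 * (1 + 2 * s t) =
  4 * (Q * (1 + 2 * s t)) / s t by field; rewrite gt_eqF.
by rewrite e; field; rewrite gt_eqF.
Qed.

(** When omega^2 > kappa this makes the logarithm of s strictly concave. *)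
Lemma is_derive_rate (t : R) : 0 < s t -> is_derive t 1 rate
  (- (4 * (omega ^+ 2 - kappa) * s t / (1 + 2 * s t) ^+ 2)).
Proof.
move=> s0; have d1 := is_derive_dev t; have d2 := is_derive_ds t.
have d3 := is_derive_invf (f := fun x => s x) (lt0r_neq0 s0) d1.
rewrite /rate; notypeclasses refine (is_derive_val _ _).
  exact: (is_derive_mulf (f := fun x => ds x) d2 d3).
have := ds_sqrE t; set D := ds t => eD.
have := wspeedE t; have := multiplierE t; have := dev_1D2_gt0 t.
move: s0 eD; set S := s t; set Q := dev (B t); set L := lam t.
move=> S0 eD S1 eL eQ.
have S1n : 1 + 2 * S != 0 by rewrite gt_eqF.
have {}eQ : Q = S * (m2 - 2 * kappa * S) / (1 + 2 * S) by rewrite -eQ mulfK.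
have {}eL : L = (kappa - omega ^+ 2 + 2 * kappa * S + 2 * Q) / (1 + 2 * S).
  by rewrite -eL mulfK.
have -> : D * (- D / S ^+ 2) = - D ^+ 2 / S ^+ 2 by ring.
by rewrite eD eL eQ; field; rewrite S1n gt_eqF.
Qed.

End Deviation.

(** * Convergence to a rotation *)

Section Asymptotics.
Context {R : realType} (kappa omega : R) (A B : R -> 'M[R]_2) (lam : R -> R).
Hypothesis kappa_gt0 : 0 < kappa.
Hypothesis omega_gt : 2 * kappa < omega ^+ 2.
Hypothesis AB : homoclinic kappa omega A B lam.

Local Notation s t := (dev (A t)).
Local Notation ds t :=
  (2 * (wre (A t) * wre (B t) + wim (A t) * wim (B t))).
Local Notation m2 := (omega ^+ 2 - 2 * kappa).

Lemma m2_gt0 : 0 < m2.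
Proof. by rewrite subr_gt0. Qed.

Lemma drift_coef_gt0 : 0 < omega ^+ 2 - kappa.
Proof. by have := m2_gt0; have := kappa_gt0; lra. Qed.

Lemma wspeed_le t : dev (B t) <= m2 * s t.
Proof.
have := wspeedE AB t; have := dev_ge0 (A t); have := dev_ge0 (B t).
move: (s t) (dev (B t)) => S Q Q0 S0 e.
have : 0 <= Q * S by rewrite mulr_ge0.
have : 0 <= kappa * (S * S) by rewrite !mulr_ge0// ltW.
by move: e; lra.
Qed.

(** Uses 4 m2 <= (m2 + 1)^2 to avoid a square root. *)
Lemma ds_le t : `|ds t| <= (m2 + 1) * s t.
Proof.
apply: sqr_le_norm_le; first by have := m2_gt0 => ?;
  rewrite mulr_ge0 ?dev_ge0//; lra.
rewrite (ds_sqrE AB) exprMn.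
have h1 : 4 * s t * dev (B t) <= 4 * s t * (m2 * s t).
  by rewrite ler_wpM2l ?wspeed_le// mulr_ge0 ?dev_ge0.
apply: (le_trans h1).
have : 0 <= (m2 - 1) ^+ 2 * s t ^+ 2 by rewrite mulr_ge0 ?sqr_ge0.
lra.
Qed.

(** Gronwall: s exp (c t) is nondecreasing and s exp (- c t) nonincreasing for
    c = m2 + 1, by the bound on ds. *)
Lemma dev_eq0_all t0 : s t0 = 0 -> forall t, s t = 0.
Proof.
move=> s0 t; apply/eqP; rewrite eq_le dev_ge0 andbT.
have wt (c x : R) : is_derive x 1 (fun x => s x * expR (c * x))
    (expR (c * x) * (ds x + c * s x)).
  by have d := is_derive_dev AB x; derive_by; ring.
have [tt|tt] := leP t0 t.
  have : s t * expR (- (m2 + 1) * t) <= s t0 * expR (- (m2 + 1) * t0).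
    apply: (is_derive_le0_nincr tt (wt _)) => x _.
    rewrite pmulr_rle0 ?expR_gt0//.
    by have := ds_le x; rewrite ler_norml => /andP[]; lra.
  by rewrite s0 mul0r pmulr_lle0 ?expR_gt0.
have : s t * expR ((m2 + 1) * t) <= s t0 * expR ((m2 + 1) * t0).
  apply: (is_derive_ge0_ndecr (ltW tt) (wt _)) => x _.
  rewrite pmulr_rge0 ?expR_gt0//.
  by have := ds_le x; rewrite ler_norml => /andP[]; lra.
by rewrite s0 mul0r pmulr_lle0 ?expR_gt0.
Qed.

(** The complex number z' - i omega z, which vanishes along rotations of
    angular velocity omega. *)
Definition drift1 t := zre (B t) + omega * zim (A t).
Definition drift2 t := zim (B t) - omega * zre (A t).

(** The drift is of order s, not only of order |w|: this is what makes it
    integrable and the phase convergent. *)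
Lemma drift_sqr_le t :
  drift1 t ^+ 2 + drift2 t ^+ 2 <= ((omega ^+ 2 - kappa + 1) * s t) ^+ 2.
Proof.
have h : drift1 t ^+ 2 + drift2 t ^+ 2 = m2 * s t - dev (B t).
  case: AB => _ /(_ t) /WsetP[_ _ e4 _].
  transitivity (zre (B t) ^+ 2 + zim (B t) ^+ 2
    + omega ^+ 2 * (zre (A t) ^+ 2 + zim (A t) ^+ 2)
    - 2 * omega * (zre (A t) * zim (B t) - zim (A t) * zre (B t))).
    by rewrite /drift1 /drift2; ring.
  rewrite (zspeedE AB) (zsqrE AB).
  have -> : zre (A t) * zim (B t) - zim (A t) * zre (B t) = omega by lra.
  ring.
rewrite h; have := wspeedE AB t; have := wspeed_le t; have := dev_ge0 (A t).
move: (s t) (dev (B t)) => S Q S0 Q1 e.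
have : 0 <= (m2 * S - Q) * S by rewrite mulr_ge0// subr_ge0.
have : 0 <= (omega ^+ 2 - kappa) ^+ 2 * S ^+ 2 by rewrite mulr_ge0 ?sqr_ge0.
move: (sqr_ge0 S) e; rewrite exprMn; lra.
Qed.

Lemma drift_le t : `|drift1 t| <= (omega ^+ 2 - kappa + 1) * s t /\
  `|drift2 t| <= (omega ^+ 2 - kappa + 1) * s t.
Proof.
have K0 : 0 <= (omega ^+ 2 - kappa + 1) * s t.
  by rewrite mulr_ge0 ?dev_ge0// addr_ge0// ltW// drift_coef_gt0.
by split; apply: sqr_le_norm_le => //; apply: le_trans (drift_sqr_le t);
  rewrite ?lerDl ?lerDr sqr_ge0.
Qed.

(** The complex number exp (- i omega t) z: the part z seen in the frame
    rotating with angular velocity omega. *)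
Definition slow1 t := cos (omega * t) * zre (A t) + sin (omega * t) * zim (A t).
Definition slow2 t := cos (omega * t) * zim (A t) - sin (omega * t) * zre (A t).

Lemma is_derive_slow (t : R) :
  is_derive t 1 slow1
    (cos (omega * t) * drift1 t - sin (omega * t) * - drift2 t)
  /\
  is_derive t 1 slow2 (cos (omega * t) * drift2 t - sin (omega * t) * drift1 t).
Proof.
have [[d1 d2 _ _] _ _ _ _] := flow_curve_coord t AB.1.
by rewrite /slow1 /slow2 /drift1 /drift2; split; derive_by; ring.
Qed.

Lemma slow_drift_le t :
  `|cos (omega * t) * drift1 t - sin (omega * t) * - drift2 t|
     <= 2 * (omega ^+ 2 - kappa + 1) * s t /\
  `|cos (omega * t) * drift2 t - sin (omega * t) * drift1 t|
     <= 2 * (omega ^+ 2 - kappa + 1) * s t.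
Proof.
have [h1 h2] := drift_le t.
by rewrite -mulrA; split; apply: norm_rotation_le; rewrite ?normrN.
Qed.

Lemma zre_slow t x y :
  zre (A t) - (cos (omega * t) * x - sin (omega * t) * y) =
  cos (omega * t) * (slow1 t - x) - sin (omega * t) * (slow2 t - y).
Proof.
rewrite /slow1 /slow2; have := cos2Dsin2 (omega * t).
move: (cos _) (sin _) => c d cd; rewrite -[zre (A t) in LHS]mul1r -cd; ring.
Qed.

Lemma zim_slow t x y :
  zim (A t) - (sin (omega * t) * x + cos (omega * t) * y) =
  cos (omega * t) * (slow2 t - y) - sin (omega * t) * - (slow1 t - x).
Proof.
rewrite /slow1 /slow2; have := cos2Dsin2 (omega * t).
move: (cos _) (sin _) => c d cd; rewrite -[zim (A t) in LHS]mul1r -cd; ring.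
Qed.

Lemma slow_sqrE t : slow1 t ^+ 2 + slow2 t ^+ 2 = 1 + s t.
Proof.
rewrite -(zsqrE AB) -[RHS]mul1r -(cos2Dsin2 (omega * t)) /slow1 /slow2; ring.
Qed.

Lemma dev0_rigid : (forall t, s t = 0) -> rigid_rotation omega A.
Proof.
move=> s0.
have cst t : slow1 t = slow1 0 /\ slow2 t = slow2 0.
  have z u : drift1 u = 0 /\ drift2 u = 0.
    have [] := drift_le u; rewrite s0 mulr0 !normr_le0 => /eqP -> /eqP ->.
    by [].
  split; move: t; apply: is_derive0_const => u;
    have [d1 d2] := is_derive_slow u.
    by move: d1; have [-> ->] := z u; rewrite oppr0 !mulr0 subr0.
  by move: d2; have [-> ->] := z u; rewrite !mulr0 subr0.
have [|theta [c1 c2]] := @unit_circle_angle _ (slow1 0) (slow2 0).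
  by rewrite slow_sqrE s0 addr0.
exists theta => t; have [e1 e2] := cst t.
have w0 : wre (A t) = 0 /\ wim (A t) = 0.
  have /eqP := s0 t; rewrite /dev paddr_eq0 ?sqr_ge0// !sqrf_eq0.
  by move=> /andP[/eqP -> /eqP ->].
apply: mx2P; rewrite coord_Umx; [ | |exact: w0.1|exact: w0.2].
  apply/eqP; rewrite cosD -c1 -c2 -subr_eq0 zre_slow e1 e2 !subrr.
  by rewrite !mulr0 subr0.
apply/eqP; rewrite sinD -c1 -c2 -subr_eq0 zim_slow e1 e2 !subrr.
by rewrite oppr0 !mulr0 subr0.
Qed.

Section NonRigid.
Hypothesis dev_gt0 : forall t, 0 < s t.
Variable mu : R.
Hypothesis mu_gt0 : 0 < mu.
Hypothesis mu_lt : mu ^+ 2 < m2.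

Lemma dev_le t : 2 * kappa * s t <= m2.
Proof.
have := wspeedE AB t; have := dev_ge0 (B t) => Q0 e.
rewrite -subr_ge0 -(pmulr_rge0 _ (dev_gt0 t)) -e mulr_ge0//.
by rewrite ltW// dev_1D2_gt0.
Qed.

Lemma rate_nincr a b : a <= b -> rate A B b <= rate A B a.
Proof.
move=> ab; apply: (is_derive_le0_nincr ab) => t.
  exact: (is_derive_rate AB (dev_gt0 t)).
move=> _; rewrite oppr_le0 divr_ge0 ?sqr_ge0// mulr_ge0 ?dev_ge0//.
by have := drift_coef_gt0; lra.
Qed.

Lemma dsE t : ds t = rate A B t * s t.
Proof. by rewrite /rate divfK// gt_eqF. Qed.

(** While s increases it stays above s 0; while it decreases at a rate slower
    than 2 mu, rate_sqrE keeps it away from 0. *)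
Lemma dev_lower_bound t : 0 <= t -> - (2 * mu) < rate A B t ->
  Num.min (s 0) ((m2 - mu ^+ 2) / (2 * (kappa + mu ^+ 2))) <= s t.
Proof.
move=> t0 mut; rewrite ge_min; have [r0|r0] := leP 0 (rate A B t).
  apply/orP; left; apply: (is_derive_ge0_ndecr t0 (is_derive_dev AB)) => x.
  move=> /andP[_ xt]; rewrite dsE mulr_ge0 ?dev_ge0//.
  exact: le_trans r0 (rate_nincr xt).
apply/orP; right; rewrite ler_pdivrMr; last first.
  by rewrite mulr_gt0// addr_gt0// exprn_gt0.
have : rate A B t ^+ 2 < 4 * mu ^+ 2.
  rewrite -sqrrN (_ : 4 * mu ^+ 2 = (2 * mu) ^+ 2); last by ring.
  by rewrite ltr_sqr ?nnegrE; lra.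
rewrite -(ltr_pM2r (dev_1D2_gt0 A t)) (rate_sqrE AB (dev_gt0 t)).
lra.
Qed.

(** Otherwise s would be bounded below on [0, +oo[, the slope of the rate would
    be bounded away from 0 by is_derive_rate, and the rate would tend
    to -oo. *)
Lemma rate_eventually_le :
  exists2 T, 0 < T & forall t, T <= t -> rate A B t <= - (2 * mu).
Proof.
suff [T0 T00 rT0] : exists2 T0, 0 <= T0 & rate A B T0 <= - (2 * mu).
  exists (T0 + 1) => [|t Tt]; first by rewrite ltr_wpDl.
  by apply: le_trans rT0; apply: rate_nincr; lra.
apply: contrapT => noT.
have gt_mu t : 0 <= t -> - (2 * mu) < rate A B t.
  by move=> t0; rewrite ltNge; apply/negP => le_mu; apply: noT; exists t.
set l := Num.min (s 0) ((m2 - mu ^+ 2) / (2 * (kappa + mu ^+ 2))).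
have l0 : 0 < l.
  rewrite lt_min dev_gt0 divr_gt0 ?subr_gt0// mulr_gt0// addr_gt0//.
  by rewrite exprn_gt0.
pose M := m2 / (2 * kappa).
pose c := 4 * (omega ^+ 2 - kappa) * l / (1 + 2 * M) ^+ 2.
have M0 : 0 < M by rewrite divr_gt0 ?mulr_gt0// m2_gt0.
have k0 := drift_coef_gt0.
have c0 : 0 < c by rewrite divr_gt0 ?exprn_gt0 ?mulr_gt0//; lra.
(* a time by which a slope below - c forces the rate under - 2 mu *)
pose t1 := (`|rate A B 0| + 2 * mu) / c.
have t10 : 0 <= t1 by rewrite divr_ge0 ?(ltW c0)// addr_ge0// mulr_ge0// ltW.
have slope : rate A B t1 - rate A B 0 <= - c * (t1 - 0).
  apply: (is_derive_slope_le t10).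
    by move=> t; exact: (is_derive_rate AB (dev_gt0 t)).
  move=> t /andP[t0 _]; rewrite lerN2 /c.
  have sM : s t <= M by rewrite ler_pdivlMr ?mulr_gt0// mulrC dev_le.
  have ls : l <= s t by apply: dev_lower_bound => //; exact: gt_mu.
  have S1 := dev_1D2_gt0 A t.
  apply: ler_pM.
  - by rewrite !mulr_ge0// ltW.
  - by rewrite invr_ge0 sqr_ge0.
  - by rewrite ler_wpM2l// mulr_ge0// ltW.
  rewrite lef_pV2 ?posrE ?exprn_gt0//; last by lra.
  by rewrite ler_sqr ?nnegrE; lra.
have := gt_mu _ t10; have := ler_norm (rate A B 0).
have ct1 : c * t1 = `|rate A B 0| + 2 * mu by rewrite /t1 mulrC divfK// gt_eqF.
by move: slope; rewrite subr0 mulNr ct1; lra.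
Qed.

Section Tail.
Variable T : R.
Hypothesis T_gt0 : 0 < T.
Hypothesis rateT : forall t, T <= t -> rate A B t <= - (2 * mu).

Lemma ds_tail t : T <= t -> ds t <= - (2 * mu) * s t.
Proof. by move=> Tt; rewrite dsE ler_wpM2r ?dev_ge0 ?rateT. Qed.

Lemma dev_tail t : T <= t ->
  s t <= s T * expR (2 * mu * T) * expR (- (mu * t)) ^+ 2.
Proof.
move=> Tt; have : s t * expR (2 * mu * t) <= s T * expR (2 * mu * T).
  apply: (is_derive_le0_nincr (f := fun x => s x * expR (2 * mu * x))
    (df := fun x => expR (2 * mu * x) * (ds x + 2 * mu * s x)) Tt) => x.
    by have d := is_derive_dev AB x; derive_by; ring.
  case/andP=> Tx _; rewrite pmulr_rle0 ?expR_gt0//.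
  by have := ds_tail Tx; lra.
move=> h; have -> : s t = s t * expR (2 * mu * t) * expR (- (mu * t)) ^+ 2.
  rewrite -mulrA expr2 -!expRD (_ : 2 * mu * t + _ = 0) ?expR0 ?mulr1//.
  by ring.
by rewrite ler_wpM2r ?sqr_ge0.
Qed.

Lemma dev_tail_small e : 0 < e -> exists2 t, T <= t & s t < e.
Proof.
move=> e0; set D := s T * expR (2 * mu * T).
have D0 : 0 < D by rewrite mulr_gt0 ?expR_gt0.
pose t := T + D / (mu * e).
have Tt : T <= t by rewrite lerDl ltW// divr_gt0// mulr_gt0.
exists t => //; apply: le_lt_trans (dev_tail Tt) _; rewrite -/D.
rewrite expRN exprVn ltr_pdivrMr ?exprn_gt0 ?expR_gt0//.
have h1 : 1 + mu * t <= expR (mu * t) by exact: expR_ge1Dx.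
have mt : mu * t = mu * T + D / e.
  by rewrite /t; field; rewrite !gt_eqF.
have De : 0 < D / e by rewrite divr_gt0.
have mT : 0 < mu * T by rewrite mulr_gt0.
have h2 : D < e * expR (mu * t).
  have -> : D = e * (D / e) by field; rewrite gt_eqF.
  by rewrite ltr_pM2l//; lra.
apply: (lt_le_trans h2); rewrite ler_wpM2l ?(ltW e0)//.
by rewrite expr2 ler_peMl ?expR_ge0//; lra.
Qed.

(** Since s <= - ds / (2 mu) on the tail, a derivative of order s is dominated
    by the decrease of a multiple of s. *)
Lemma slow_limit (f df : R -> R) (K : R) : 0 <= K ->
  (forall t : R, is_derive t 1 f (df t)) ->
  (forall t, `|df t| <= K * s t) ->
  exists l, forall t, T <= t -> `|f t - l| <= K / (2 * mu) * s t.
Proof.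
move=> K0 fd dfK; apply: controlled_limit => [t _|a b Ta ab].
  by rewrite mulr_ge0 ?dev_ge0// divr_ge0// mulr_ge0// ltW.
have k0 : 0 <= K / (2 * mu) by rewrite divr_ge0// mulr_ge0// ltW.
have mono e : (forall x, e * df x <= K * s x) ->
    e * f b + K / (2 * mu) * s b <= e * f a + K / (2 * mu) * s a.
  move=> eK; apply: (is_derive_le0_nincr
    (f := fun x => e * f x + K / (2 * mu) * s x)
    (df := fun x => e * df x + K / (2 * mu) * ds x) ab) => x.
    by have d1 := fd x; have d2 := is_derive_dev AB x; derive_by; ring.
  case/andP=> ax _; have /(ler_wpM2l k0) := ds_tail (le_trans Ta ax).
  have -> : K / (2 * mu) * (- (2 * mu) * s x) = - (K * s x).
    by field; rewrite gt_eqF.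
  by have := eK x; lra.
have upper : 1 * f b + K / (2 * mu) * s b <= 1 * f a + K / (2 * mu) * s a.
  by apply: mono => x; have := dfK x; rewrite ler_norml => /andP[]; lra.
have lower : -1 * f b + K / (2 * mu) * s b <= -1 * f a + K / (2 * mu) * s a.
  by apply: mono => x; have := dfK x; rewrite ler_norml => /andP[]; lra.
by rewrite ler_norml; apply/andP; split; lra.
Qed.

(** The limit of the slow variable lies on the unit circle, because
    |slow|^2 = 1 + s; its angle is the asymptotic phase. *)
Lemma phase_limit : exists theta c, 0 <= c /\ forall t, T <= t ->
  `|zre (A t) - cos (omega * t + theta)| <= c * s t /\
  `|zim (A t) - sin (omega * t + theta)| <= c * s t.
Proof.
have K0 : 0 <= 2 * (omega ^+ 2 - kappa + 1).
  by rewrite mulr_ge0// addr_ge0// ltW// drift_coef_gt0.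
have [l1 h1] := slow_limit K0 (fun t => (is_derive_slow t).1)
  (fun t => (slow_drift_le t).1).
have [l2 h2] := slow_limit K0 (fun t => (is_derive_slow t).2)
  (fun t => (slow_drift_le t).2).
set g := 2 * (omega ^+ 2 - kappa + 1) / (2 * mu) in h1 h2.
have g0 : 0 <= g by rewrite divr_ge0// mulr_ge0// ltW.
have sq (x l c : R) : 0 <= c -> `|x - l| <= c ->
    `|x ^+ 2 - l ^+ 2| <= c * (2 * `|l| + c).
  move=> c0 xl; have -> : x ^+ 2 - l ^+ 2 = (x - l) * (2 * l + (x - l)) by ring.
  rewrite normrM ler_pM//; apply: (le_trans (ler_normD _ _)).
  by rewrite normrM ger0_norm// lerD2l.
(* |l1^2 + l2^2 - 1| is at most D s t, and s t takes arbitrarily small values *)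
pose D := 1 + g * (2 * `|l1| + g) + g * (2 * `|l2| + g).
have D0 : 0 < D.
  by rewrite /D -addrA ltr_pwDl// addr_ge0// mulr_ge0// addr_ge0// mulr_ge0.
have near1 t : T <= t -> s t <= 1 -> `|1 - (l1 ^+ 2 + l2 ^+ 2)| <= D * s t.
  move=> Tt s1; have s0 := dev_ge0 (A t).
  have gs0 : 0 <= g * s t by rewrite mulr_ge0.
  have q1 := sq _ _ _ gs0 (h1 _ Tt); have q2 := sq _ _ _ gs0 (h2 _ Tt).
  have gs1 : g * s t <= g by rewrite -[leRHS]mulr1 ler_wpM2l.
  have b1 : g * s t * (2 * `|l1| + g * s t) <= g * s t * (2 * `|l1| + g).
    by rewrite ler_wpM2l// lerD2l.
  have b2 : g * s t * (2 * `|l2| + g * s t) <= g * s t * (2 * `|l2| + g).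
    by rewrite ler_wpM2l// lerD2l.
  have e := slow_sqrE t.
  move: q1 q2; rewrite /D !ler_norml => /andP[? ?] /andP[? ?].
  by apply/andP; split; lra.
have l12 : l1 ^+ 2 + l2 ^+ 2 = 1.
  apply/eqP; rewrite eq_sym -subr_eq0 -normr_eq0 eq_le normr_ge0 andbT.
  rewrite leNgt; apply/negP => d0; set d := `|_| in d0 near1.
  have [|t Tt] := @dev_tail_small (Num.min 1 (d / D)).
    by rewrite lt_min ltr01 divr_gt0.
  rewrite lt_min => /andP[/ltW s1]; rewrite ltr_pdivlMr// mulrC.
  by rewrite ltNge near1.
have [theta [c1 c2]] := unit_circle_angle l12.
exists theta, (2 * g); split; first by rewrite mulr_ge0.
move=> t Tt; rewrite cosD sinD -c1 -c2 zre_slow zim_slow -(mulrA 2 g (s t)).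
have n1 := h1 _ Tt; have n2 := h2 _ Tt.
by split; apply: norm_rotation_le; rewrite ?normrN.
Qed.

Lemma phase_velocity_le theta c t : 0 <= c ->
  `|zre (A t) - cos (omega * t + theta)| <= c * s t ->
  `|zim (A t) - sin (omega * t + theta)| <= c * s t ->
  `|zre (B t) + omega * sin (omega * t + theta)|
    <= (omega ^+ 2 - kappa + 1 + `|omega| * c) * s t /\
  `|zim (B t) - omega * cos (omega * t + theta)|
    <= (omega ^+ 2 - kappa + 1 + `|omega| * c) * s t.
Proof.
move=> c0 a1 a2; have [b1 b2] := drift_le t; split.
- have -> : zre (B t) + omega * sin (omega * t + theta) =
    drift1 t - omega * (zim (A t) - sin (omega * t + theta)).
    by rewrite /drift1; ring.
  apply: (le_trans (ler_normB _ _)); rewrite mulrDl lerD// normrM -mulrA.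
  by rewrite ler_wpM2l.
- have -> : zim (B t) - omega * cos (omega * t + theta) =
    drift2 t + omega * (zre (A t) - cos (omega * t + theta)).
    by rewrite /drift2; ring.
  apply: (le_trans (ler_normD _ _)); rewrite mulrDl lerD// normrM -mulrA.
  by rewrite ler_wpM2l.
Qed.

(** A bound by s gives the decay exp (- 2 mu t), more than needed; the parts
    w and w' are bounded only by the square root of s. *)
Lemma dev_tail_bounds : exists2 D, 0 <= D & forall t, T <= t ->
  s t <= D * expR (- (mu * t)) /\
  forall x, x ^+ 2 <= (m2 + 1) * s t -> `|x| <= D * expR (- (mu * t)).
Proof.
set C := s T * expR (2 * mu * T).
have C0 : 0 <= C by rewrite mulr_ge0 ?dev_ge0 ?expR_ge0.
have m20 := m2_gt0; have mC : 0 <= m2 * C by rewrite mulr_ge0// ltW.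
exists ((m2 + 1) * (C + 1)) => [|t Tt]; first by lra.
have sE := dev_tail Tt; rewrite -/C in sE.
have tmu : 0 <= mu * t.
  by rewrite mulr_ge0 ?(ltW mu_gt0)// (le_trans (ltW T_gt0) Tt).
have E1 : expR (- (mu * t)) <= 1 by rewrite -expR0 ler_expR oppr_le0.
have E0 := expR_gt0 (- (mu * t)).
move: (expR _) sE E1 E0 => E sE E1 E0; split.
  apply: (@le_trans _ _ (C * E)); last by rewrite ler_wpM2r ?(ltW E0)//; lra.
  apply: (le_trans sE); rewrite ler_wpM2l// expr2 -[leRHS]mul1r ler_wpM2r//.
  exact: ltW.
move=> x xs; apply: sqr_le_norm_le.
  by rewrite mulr_ge0 ?(ltW E0)//; lra.
apply: (le_trans xs); apply: (@le_trans _ _ ((m2 + 1) * (C * E ^+ 2))).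
  by rewrite ler_wpM2l//; lra.
rewrite exprMn mulrA ler_wpM2r ?sqr_ge0//.
have h1 : 0 <= m2 * (m2 + 1) * (C + 1) ^+ 2.
  by rewrite mulr_ge0 ?sqr_ge0// mulr_ge0//; lra.
have C2 := sqr_ge0 C.
have h2 : 0 <= (m2 + 1) * (C ^+ 2 + C + 1) by rewrite mulr_ge0//; lra.
by lra.
Qed.

Lemma tail_asymptotics : exists theta c, 0 <= c /\ forall t, T <= t ->
  mxnorm (A t - Umx (omega * t + theta)) <= c * expR (- (mu * t)) /\
  mxnorm (B t - omega *: (Zmx *m Umx (omega * t + theta)))
    <= c * expR (- (mu * t)).
Proof.
have [theta [c [c0 h]]] := phase_limit.
have [D D0 tail] := dev_tail_bounds.
pose k := omega ^+ 2 - kappa + 1 + `|omega| * c.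
have oc0 : 0 <= `|omega| * c by rewrite mulr_ge0.
have k0 : 0 <= k by have := drift_coef_gt0; rewrite /k; lra.
pose g := 1 + c + k.
have g0 : 0 <= g by rewrite /g; lra.
exists theta, (3 * (g * D)); split; first by rewrite !mulr_ge0.
move=> t Tt; have [a1 a2] := h _ Tt.
have [b1 b2] := phase_velocity_le c0 a1 a2; rewrite -/k in b1 b2.
have [sE sqE] := tail _ Tt.
have E0 := expR_gt0 (- (mu * t)); set E := expR _ in sE sqE E0 *.
have s0 := dev_ge0 (A t).
have DE0 : 0 <= D * E by rewrite mulr_ge0// ltW.
have bound (x l : R) : 0 <= l -> l <= g -> `|x| <= l * s t -> `|x| <= g * D * E.
  move=> l0 lg xl; apply: (le_trans xl).
  by rewrite -mulrA ler_pM.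
have wbound (x : R) : x ^+ 2 <= (m2 + 1) * s t -> `|x| <= g * D * E.
  move=> /sqE xD; apply: (le_trans xD); rewrite -mulrA ler_peMl//.
  by rewrite /g; lra.
have wA : dev (A t) <= (m2 + 1) * s t.
  have : 0 <= m2 * s t by rewrite mulr_ge0// ltW// m2_gt0.
  by lra.
have wB : dev (B t) <= (m2 + 1) * s t by have := wspeed_le t; lra.
have wre_le (M : 'M[R]_2) : wre M ^+ 2 <= dev M by rewrite lerDl sqr_ge0.
have wim_le (M : 'M[R]_2) : wim M ^+ 2 <= dev M by rewrite lerDr sqr_ge0.
have gDE0 : 0 <= g * D * E by rewrite -mulrA mulr_ge0.
have kg : k <= g by rewrite /g; lra.
have cg : c <= g by rewrite /g; lra.
split; rewrite -(mulrA 3 (g * D) E); apply: mxnorm_le => //.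
- by rewrite coordD coordN coord_Umx; exact: bound _ _ c0 cg a1.
- by rewrite coordD coordN coord_Umx; exact: bound _ _ c0 cg a2.
- rewrite coordD coordN coord_Umx subr0; apply: wbound.
  exact: le_trans (wre_le (A t)) wA.
- rewrite coordD coordN coord_Umx subr0; apply: wbound.
  exact: le_trans (wim_le (A t)) wA.
- rewrite coordD coordN coordZ coord_ZUmx mulrN opprK.
  exact: bound _ _ k0 kg b1.
- rewrite coordD coordN coordZ coord_ZUmx.
  exact: bound _ _ k0 kg b2.
- rewrite coordD coordN coordZ coord_ZUmx mulr0 subr0; apply: wbound.
  exact: le_trans (wre_le (B t)) wB.
- rewrite coordD coordN coordZ coord_ZUmx mulr0 subr0; apply: wbound.
  exact: le_trans (wim_le (B t)) wB.
Qed.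

End Tail.
End NonRigid.

(** If w vanishes once, the curve is a rotation and there is nothing to
    estimate; otherwise s > 0 and its rate is eventually below - 2 mu. *)
Lemma homoclinic_forward mu : 0 < mu -> mu ^+ 2 < m2 ->
  exists T theta c, [/\ 0 < T, 0 <= c & forall t, T < t ->
  [/\ mxnorm (A t - Umx (omega * t + theta)) <= c * expR (- (mu * t)),
      mxnorm (B t - omega *: (Zmx *m Umx (omega * t + theta)))
        <= c * expR (- (mu * t))
    & ~ rigid_rotation omega A -> mxdot (A t) (B t) < 0]].
Proof.
move=> mu0 mum; have [[t0 s0]|sn0] := pselect (exists t0, s t0 = 0).
  have rA := dev0_rigid (dev_eq0_all s0); have [theta At] := rA.
  have Bt t : B t = omega *: (Zmx *m Umx (omega * t + theta)).
    have AU : A = (fun t => Umx (omega * t + theta)) by apply/funext.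
    have [+ _] := AB.1 t; rewrite AU => -[_ <-].
    by have [_ ->] := is_derive_Umx omega theta t.
  have n0 : mxnorm (0 : 'M[R]_2) = 0.
    by rewrite /mxnorm /mxdot mulmx0 mxtrace0 sqrtr0.
  by exists 1, theta, 0; split=> // t _; rewrite At Bt !subrr n0 !mul0r; split.
have sgt0 t : 0 < s t.
  rewrite lt_neqAle dev_ge0 andbT eq_sym; apply/eqP => st0.
  by apply: sn0; exists t.
have [T T0 rT] := rate_eventually_le sgt0 mu0 mum.
have [theta [c [c0 h]]] := tail_asymptotics sgt0 mu0 T0 rT.
exists T, theta, c; split=> // t Tt; have [h1 h2] := h _ (ltW Tt).
split=> // _; rewrite mxdotE.
have /WsetP[[_ e2] _ _ _] := AB.2 t.
have := ds_tail sgt0 rT (ltW Tt).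
have : 0 < mu * s t by rewrite mulr_gt0.
by lra.
Qed.

End Asymptotics.

(** * Existence, invariance and time reversal *)

Section Curves.
Context {R : realType}.

(** The identity matrix with the velocity of a rotation belongs to W. *)
Lemma Wset_nonempty (kappa omega : R) :
  Wset kappa (kappa + omega ^+ 2) (2 * omega) !=set0.
Proof.
exists (1%:M, omega *: Zmx); apply/WsetP; rewrite !coordZ !coord1 !coordZmx.
by split; [split|..]; ring.
Qed.

Lemma solution_Wset_invariant (kappa x1 x3 : R) :
  flow_invariant kappa (Wset kappa x1 x3).
Proof.
move=> f sol W0; have [lam fl] := solution_flow_curve sol.
by apply: (Wset_invariant fl) => // t; case: sol => _ /(_ t).
Qed.

Lemma rigid_rotation_reverse (omega : R) (A : R -> 'M[R]_2) :
  rigid_rotation (- omega) (fun t => A (- t)) -> rigid_rotation omega A.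
Proof.
by case=> theta h; exists theta => t; have := h (- t); rewrite opprK mulrNN.
Qed.

Lemma derive_sub_Umx (A B : R -> 'M[R]_2) (omega theta t : R) :
  is_derive t 1 A (B t) ->
  derive1 (fun s => A s - Umx (omega * s + theta)) t =
  B t - omega *: (Zmx *m Umx (omega * t + theta)).
Proof.
move=> dA; have dU := is_derive_Umx omega theta t.
by rewrite derive1E; have [_ ->] := is_deriveB dA dU.
Qed.

End Curves.

Theorem theorem11p2 (R : realType) (kappa x1 x3 : R)
    (kappa_gt0 : 0 < kappa)
    (x1E : x1 = kappa + 4^-1 * x3 ^+ 2)
    (x3_gt : 8 * kappa < x3 ^+ 2) :
  [/\ Wset kappa x1 x3 !=set0,
      flow_invariant kappa (Wset kappa x1 x3)
    & forall mu : R, 0 < mu -> mu < 2^-1 * Num.sqrt (x3 ^+ 2 - 8 * kappa) ->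
      forall A : R -> 'M[R]_2, is_solution kappa A ->
      forall A0 B0 : 'M[R]_2, A 0 = A0 -> derive1 A 0 = B0 ->
      Wset kappa x1 x3 (A0, B0) ->
      exists T thetap thetam : R,
      [/\ 0 < T,
          forall j : nat, (j <= 1)%N ->
            lesssim [set t | T < t]
              (fun t => mxnorm
                 (derive1n j (fun s => A s - Umx (2^-1 * x3 * s + thetap)) t))
              (fun t => expR (- (mu * t))),
          forall j : nat, (j <= 1)%N ->
            lesssim [set t | t < - T]
              (fun t => mxnorm
                 (derive1n j (fun s => A s - Umx (2^-1 * x3 * s + thetam)) t))
              (fun t => expR (mu * t))
        & ~ rigid_rotation (2^-1 * x3) A ->
            (forall t, T < t -> mxdot (A t) (derive1 A t) < 0) /\
            (forall t, t < - T -> 0 < mxdot (A t) (derive1 A t))]].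
Proof.
pose omega : R := 2^-1 * x3.
have x3E : x3 = 2 * omega by rewrite /omega; field.
have {}x1E : x1 = kappa + omega ^+ 2 by rewrite x1E /omega; field.
have omega_gt : 2 * kappa < omega ^+ 2.
  by rewrite x3E in x3_gt; lra.
rewrite -/omega; split.
- by rewrite x1E x3E; exact: Wset_nonempty.
- exact: solution_Wset_invariant.
move=> mu mu0 mu_lt A sol A0 B0 A0E B0E W0.
have mum : mu ^+ 2 < omega ^+ 2 - 2 * kappa.
  have h : (2 * mu) ^+ 2 < Num.sqrt (x3 ^+ 2 - 8 * kappa) ^+ 2.
    by rewrite ltr_sqr ?nnegrE ?sqrtr_ge0//; lra.
  rewrite sqr_sqrtr in h; last by rewrite subr_ge0 ltW.
  by rewrite x3E in h; lra.
have [lam fl] := solution_flow_curve sol.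
have AB : homoclinic kappa omega A (derive1 A) lam.
  split=> // t; rewrite -x1E -x3E; apply: solution_Wset_invariant => //.
  by rewrite A0E B0E.
(* the behaviour at -oo is that of the reversed curve at +oo *)
have ABr := homoclinic_reverse AB.
have omegaN_gt : 2 * kappa < (- omega) ^+ 2 by rewrite sqrrN.
have muNm : mu ^+ 2 < (- omega) ^+ 2 - 2 * kappa by rewrite sqrrN.
have [Tp [thetap [cp [Tp0 cp0 hp]]]] :=
  homoclinic_forward kappa_gt0 omega_gt AB mu0 mum.
have [Tm [thetam [cm [Tm0 cm0 hm]]]] :=
  homoclinic_forward kappa_gt0 omegaN_gt ABr mu0 muNm.
have reorient t : - omega * - t + thetam = omega * t + thetam by ring.
exists (Num.max Tp Tm), thetap, thetam; split.
- by rewrite lt_max Tp0.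
- move=> j j1; exists cp => t /=; rewrite gt_max => /andP[/hp[h1 h2 _] _].
  case: j j1 => [|[|//]] _; rewrite ?derive1n0 ?derive1n1//.
  by rewrite (derive_sub_Umx _ _ (fl t).1).
- move=> j j1; exists cm => t /=; rewrite ltrNr gt_max => /andP[_ /hm].
  rewrite opprK reorient mulrN opprK => -[h1 h2 _].
  case: j j1 => [|[|//]] _; rewrite ?derive1n0 ?derive1n1//.
  rewrite (derive_sub_Umx _ _ (fl t).1).
  move: h2; rewrite scaleNr opprK -mxnormN opprD opprK.
  by [].
- move=> nrA; split=> t.
    by rewrite gt_max => /andP[/hp[_ _ h] _]; exact: h.
  rewrite ltrNr gt_max => /andP[_ /hm[_ _]]; rewrite opprK mxdotNr oppr_lt0.
  by apply=> /rigid_rotation_reverse.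
Qed.
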